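(* Let $n\ge2$, let $K\subset\mathbb{R}^n$ be a convex body, let $C\subset\mathbb{R}^n$ be a Minkowski-centered convex body with $0$ in its interior, and let $s\in\mathbb{R}^n\setminus\{0\}$. Write $C_{\mathrm{HM}}=\left(\frac{C^\circ-C^\circ}{2}\right)^\circ$. Then: (i) $$l_{s,\mathrm{HM}}(K,C)=\max_{x,y\in K,\ x-y\in\mathrm{lin}(s)}\|x-y\|_{C_{\mathrm{HM}}}=l_{s,\mathrm{HM}}(K,C_{\mathrm{HM}})=l_{s,\mathrm{AM}}(K,C_{\mathrm{HM}})=l_{s,\mathrm{HM}}\left(\tfrac{K-K}{2},C_{\mathrm{HM}}\right)=l_{s,\mathrm{HM}}\left(\tfrac{K-K}{2},C\right);$$ (ii) $$D_{\mathrm{HM}}(K,C)=D_{\mathrm{HM}}(K,C_{\mathrm{HM}})=D_{\mathrm{HM}}\left(\tfrac{K-K}{2},C_{\mathrm{HM}}\right)=D_{\mathrm{HM}}\left(\tfrac{K-K}{2},C\right)=D_{\mathrm{AM}}(K,C_{\mathrm{HM}}).$$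
   Context: A convex body is a nonempty compact convex set. $\|x\|_C=\min\{\lambda\ge0:x\in\lambda C\}$ is the gauge function; $C^\circ=\{a:a^Tx\le1\ \forall x\in C\}$ is the polar; $\mathrm{lin}(s)=\{\lambda s:\lambda\in\mathbb{R}\}$; $[x,y]$ is the segment with endpoints $x,y$. The circumradius is $R(K,C)=\inf\{\rho\ge0:\exists t,\ K\subset t+\rho C\}$. $C$ is Minkowski-centered if $C\subset -R(C,-C)\,C$. For a convex body $K$, a gauge $C$ (convex body with $0$ in its interior) and $s\ne0$: $$l_{s,\mathrm{HM}}(K,C)=\max_{x,y\in K,\ x-y\in\mathrm{lin}(s)}\tfrac12\left(\|x-y\|_C+\|x-y\|_{-C}\right),\qquad l_{s,\mathrm{AM}}(K,C)=\max_{x,y\in K,\ x-y\in\mathrm{lin}(s)}2R([x,y],C),$$ $$D_{\mathrm{HM}}(K,C)=\max_{s\ne0}l_{s,\mathrm{HM}}(K,C),\qquad D_{\mathrm{AM}}(K,C)=\max_{s\ne0}l_{s,\mathrm{AM}}(K,C).$$ *)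

(* Defs.v *)
From HB Require Import structures.
From mathcomp Require Export all_boot all_order all_algebra.
From mathcomp Require Export all_classical all_reals all_analysis.
Export numFieldNormedType.Exports.
Export Order.TTheory GRing.Theory Num.Theory.

Set Implicit Arguments.
Unset Strict Implicit.
Unset Printing Implicit Defensive.

Local Open Scope classical_set_scope.
Local Open Scope ring_scope.

Section Extrema.
Variable R : realType.
Implicit Types (A : set R) (m : R).

Definition is_max A m := A m /\ ubound A m.
Definition is_min A m := A m /\ lbound A m.
Definition has_max A := exists m, is_max A m.

(* [maximum A] and [minimum A] take the dummy value 0 when the extremum is
   not attained. *)
Definition maximum A : R := xget 0 (is_max A).
Definition minimum A : R := xget 0 (is_min A).

Lemma maximumE A m : is_max A m -> maximum A = m.
Proof.
move=> [Am mA]; rewrite /maximum; case: xgetP => [y _ [Ay yA]|/(_ m) []] //.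
by apply/eqP; rewrite eq_le mA// yA.
Qed.

Lemma minimumE A m : is_min A m -> minimum A = m.
Proof.
move=> [Am mA]; rewrite /minimum; case: xgetP => [y _ [Ay yA]|/(_ m) []] //.
by apply/eqP; rewrite eq_le yA// mA.
Qed.

End Extrema.

Section ConvexBodies.
Variables (R : realType) (n : nat).
Local Notation V := 'rV[R]_n.
Implicit Types (K C A B : set V) (a s x y t : V).

Definition dotp a x : R := \sum_(i < n) a 0 i * x 0 i.

Definition scale_set (l : R) A : set V := [set l *: x | x in A].
Definition translate t A : set V := [set t + x | x in A].
Definition diff_set A B : set V := [set x - y | x in A & y in B].

Definition opp_set A : set V := scale_set (-1) A.
Definition half_diff A : set V := scale_set 2^-1 (diff_set A A).

Definition convex_body K :=
  [/\ K !=set0, compact K & convex_set (K : set (convex_lmodType V))].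

Definition gauge_set C x : set R := [set l | 0 <= l /\ scale_set l C x].

(* the gauge function ||x||_C *)
Definition gaugef C x : R := minimum (gauge_set C x).

Lemma gaugefP C x : compact C -> interior C 0 ->
  is_min (gauge_set C x) (gaugef C x).
Proof.
move=> cC C0; suff [m mm] : exists m, is_min (gauge_set C x) m.
  by rewrite /gaugef (minimumE mm).
have [->|x0] := eqVneq x 0.
  exists 0; split; last by move=> l [].
  by split=> //; exists 0; [exact: nbhs_singleton|rewrite scaler0].
have nx : 0 < `|x| by rewrite normr_gt0.
have scx : continuous (fun l : R => l *: x).
  by move=> l; exact: scalel_continuous.
pose B := [set l : R | C (l *: x)].
have clB : closed B.
  apply: (iffLR (continuous_closedP _) scx).
  by apply: compact_closed => //; exact: norm_hausdorff.
have [e e0 Be] : exists2 e : R, 0 < e & B e.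
  have : \forall l \near (0 : R)^'+, B l.
    by apply: cvg_within; apply: scx; rewrite /= scale0r.
  move=> /(filterI (nbhs_right_gt (0 : R))) /filter_ex [e [e0 Be]].
  by exists e.
have [M CM] : exists M, forall c, C c -> `|c| <= M.
  have bC : bounded_set C := compact_bounded cC.
  move: bC; rewrite /bounded_set /bounded_near => /filter_ex [M CM].
  by exists M.
have hB : has_sup B.
  split; first by exists e.
  exists (M / `|x|) => l /CM; rewrite normrZ ler_pdivlMr//; apply: le_trans.
  by rewrite ler_wpM2r// ler_norm.
have Bs : B (sup B).
  apply: itv_closed_supremums => //; first by exists e.
  split; first exact: sup_upper_bound.
  by move=> y yB; apply: ge_sup => //; exists e.
have s0 : 0 < sup B by apply: lt_le_trans e0 _; exact: sup_upper_bound.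
exists (sup B)^-1; split.
  split; first by rewrite invr_ge0 ltW.
  by exists (sup B *: x) => //; rewrite scalerA mulVf ?scale1r ?gt_eqF.
move=> l [l0 [c Cc lc]].
have lp : 0 < l.
  rewrite lt_neqAle l0 andbT; apply/eqP => l00.
  by move: lc x0; rewrite -l00 scale0r => <-; rewrite eqxx.
rewrite -[leRHS]invrK lef_pV2 ?posrE ?invr_gt0//.
apply: sup_upper_bound => //.
by rewrite /B/= -lc scalerA mulVf ?scale1r ?gt_eqF.
Qed.

Definition polar C : set V := [set a | forall x, C x -> dotp a x <= 1].

Definition line s : set V := [set l *: s | l in [set: R]].

Definition segment x y : set V :=
  [set (1 - l) *: x + l *: y | l in `[0, 1]].

Definition circumradius K C : R :=
  inf [set rho | 0 <= rho /\ exists t, K `<=` translate t (scale_set rho C)].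

Definition minkowski_centered C :=
  C `<=` scale_set (- circumradius C (opp_set C)) C.

(* the harmonic mean of C and -C *)
Definition HM_body C : set V := polar (half_diff (polar C)).

(* values of f on the pairs of points of K whose difference is parallel to s *)
Definition chord_values (f : V -> V -> R) s K : set R :=
  [set r | exists x y, [/\ K x, K y, line s (x - y) & r = f x y]].

Definition len C x y : R := gaugef C (x - y).

Definition lenHM C x y : R :=
  2^-1 * (gaugef C (x - y) + gaugef (opp_set C) (x - y)).

Definition lenAM C x y : R := 2 * circumradius (segment x y) C.

Definition lHM s K C : R := maximum (chord_values (lenHM C) s K).
Definition lAM s K C : R := maximum (chord_values (lenAM C) s K).

Definition lHM_values K C : set R := [set lHM s K C | s in [set s | s != 0]].
Definition lAM_values K C : set R := [set lAM s K C | s in [set s | s != 0]].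

Definition DHM K C : R := maximum (lHM_values K C).
Definition DAM K C : R := maximum (lAM_values K C).

End ConvexBodies.

(* Main.v *)
Require Import Defs.
From mathcomp Require Import ring lra.

(** Put N x = (||x||_C + ||-x||_C) / 2. Since ||x||_{-C} = ||-x||_C, the harmonic
    length of a chord [x, y] of K is N (x - y), and N is an honest norm.

    The point is that N is the norm whose unit ball is C_HM ([HM_bodyE]).
    By duality, ||x||_C is the supremum of a.x over a in the polar of C
    ([dotp_le_gaugef], [lt_gaugef_dotp]), so the supremum of c.x over c in half
    of (polar C - polar C) is N x, and x lies in the polar of that set exactly
    when N x <= 1. The duality rests on the separation of a point from a compact
    convex set, obtained by projecting the point onto the set
    ([polar_separation]).

    For a norm f with unit ball B, the gauges of B and of -B are both f, and the
    circumradius of a segment [x, y] relative to B is f (x - y) / 2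
    ([circumradius_segment]). With B = C_HM, the four length functions of the
    statement are all (x, y) |-> N (x - y). Finally, K and (K - K) / 2 have the
    same set of differences ([diff_set_half_diff]), and a maximum of N (x - y)
    over chords depends on that set only. So each chain of equalities compares
    identical sets of values.

    The maxima are attained because N is continuous and K - K is compact: a
    difference z maximizing N over K - K also maximizes it among the chords
    parallel to z, which gives the maximum over all directions. *)

Set Implicit Arguments.
Unset Strict Implicit.
Unset Printing Implicit Defensive.

Local Open Scope classical_set_scope.
Local Open Scope ring_scope.

(** * Dot product and separation of a point from a convex body *)

Section DotProduct.
Variables (R : realType) (n : nat).
Implicit Types (C : set 'rV[R]_n) (a x y : 'rV[R]_n).

Lemma dotpC a x : dotp a x = dotp x a.
Proof. by apply: eq_bigr => i _; rewrite mulrC. Qed.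

Lemma dotpDr a x y : dotp a (x + y) = dotp a x + dotp a y.
Proof. by rewrite -big_split; apply: eq_bigr => i _; rewrite !mxE mulrDr. Qed.

Lemma dotpZr a (l : R) x : dotp a (l *: x) = l * dotp a x.
Proof. by rewrite /dotp mulr_sumr; apply: eq_bigr => i _; rewrite !mxE mulrCA. Qed.

Lemma dotpNr a x : dotp a (- x) = - dotp a x.
Proof. by rewrite -scaleN1r dotpZr mulN1r. Qed.

Lemma dotpBr a x y : dotp a (x - y) = dotp a x - dotp a y.
Proof. by rewrite dotpDr dotpNr. Qed.

Lemma dotpBl a x y : dotp (x - y) a = dotp x a - dotp y a.
Proof. by rewrite dotpC dotpBr !(dotpC a). Qed.

Lemma dotpZl a (l : R) x : dotp (l *: a) x = l * dotp a x.
Proof. by rewrite dotpC dotpZr dotpC. Qed.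

Lemma dotp_sqrB a (l : R) x :
  dotp (a - l *: x) (a - l *: x) = dotp a a - 2 * l * dotp a x + l ^+ 2 * dotp x x.
Proof. rewrite !(dotpBl, dotpBr, dotpZl, dotpZr) (dotpC x a); ring. Qed.

Lemma dotpxx_ge0 x : 0 <= dotp x x.
Proof. by apply: sumr_ge0 => i _; rewrite -expr2 sqr_ge0. Qed.

Lemma dotpxx_eq0 x : dotp x x = 0 -> x = 0.
Proof.
move=> /eqP; rewrite psumr_eq0 => [/allP xx|i _]; last by rewrite -expr2 sqr_ge0.
apply/rowP => i; rewrite mxE; apply/eqP.
by have := xx i (mem_index_enum _); rewrite -expr2 sqrf_eq0.
Qed.

Lemma dotp_sqr_dist_continuous y : continuous (fun x => dotp (y - x) (y - x)).
Proof.
apply: (@continuous_big _ _ +%R 0); first exact: add_continuous.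
move=> i _ x.
have ci : continuous (fun x : 'rV[R]_n => (y - x) 0 i).
  have -> : (fun x => (y - x) 0 i) = (fun x : 'rV[R]_n => y 0 i - x 0 i).
    by apply/funext => z; rewrite !mxE.
  move=> z; apply: (@continuousB R _ _ (cst (y 0 i)) (fun x : 'rV[R]_n => x 0 i)).
    exact: cst_continuous.
  exact: coord_continuous.
exact: cvgM (ci x) (ci x).
Qed.

Lemma convex_set_comb C a x (l : R) : convex_set (C : set (convex_lmodType 'rV[R]_n)) ->
  0 <= l <= 1 -> C a -> C x -> C (l *: a + (1 - l) *: x).
Proof.
move=> convC /andP[l0 l1] Ca Cx.
have l01 : Itv.spec (@Itv.num_sem R) (Itv.Real `[0%Z, 1%Z]) l.
  by rewrite /Itv.num_sem/= num_real/= in_itv/= l0 l1.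
by have := convC a x (Itv.mk l01) (mem_set Ca) (mem_set Cx); rewrite inE.
Qed.

(** Let p be the point of C nearest to y, and d = y - p. Minimality of p makes
    d.x <= d.p on C, while d.p < d.y; rescaling d by a number strictly between
    d.p and d.y puts it in the polar of C. As 0 is in C, d.p >= 0, so such a
    number is positive. *)
Lemma polar_separation C y : compact C ->
    convex_set (C : set (convex_lmodType 'rV[R]_n)) -> C 0 -> ~ C y ->
  exists2 a, polar C a & 1 < dotp a y.
Proof.
move=> cC convC C0 Cy.
have [|p /set_mem Cp minp] := @EVT_min_rV R n _ C _ cC
  (continuous_subspaceT (@dotp_sqr_dist_continuous y)); first by exists 0.
have d_gt0 : 0 < dotp (y - p) (y - p).
  rewrite lt_neqAle dotpxx_ge0 andbT; apply/eqP => /esym/dotpxx_eq0/eqP.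
  by rewrite subr_eq0 => /eqP yp; apply: Cy; rewrite yp.
set d := y - p in d_gt0 *.
have dC x : C x -> dotp d x <= dotp d p.
  move=> Cx; rewrite leNgt; apply/negP => dxp.
  set q := x - p; have dq : 0 < dotp d q by rewrite dotpBr subr_gt0.
  have q_gt0 : 0 < dotp q q.
    rewrite lt_neqAle dotpxx_ge0 andbT; apply/eqP => /esym/dotpxx_eq0 q0.
    by move: dq; rewrite q0 -(scale0r q) dotpZr mul0r ltxx.
  (* If d.(x - p) > 0, then moving from p towards x gives a point nearer to y. The
     quadratic t |-> |d - t q|^2 is minimal at t = d.q / q.q; capping t at 1
     keeps the point in C. *)
  pose t := Num.min 1 (dotp d q / dotp q q).
  have t0 : 0 < t by rewrite lt_min ltr01 divr_gt0.
  have tq : t * dotp q q <= dotp d q by rewrite -ler_pdivlMr// ge_min lexx orbT.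
  have t1 : t <= 1 by rewrite ge_min lexx.
  have /mem_set/minp : C (t *: x + (1 - t) *: p).
    by apply: convex_set_comb => //; rewrite (ltW t0).
  have -> : y - (t *: x + (1 - t) *: p) = d - t *: q.
    apply/rowP => i; rewrite !mxE; ring.
  rewrite -/d dotp_sqrB.
  by nra.
have dp_ge0 : 0 <= dotp d p.
  by have := dC _ C0; rewrite -(scale0r d) dotpZr mul0r.
have dpy : dotp d p < dotp d y by rewrite -subr_gt0 -dotpBr.
pose m := (dotp d p + dotp d y) / 2.
have m0 : 0 < m by rewrite /m; lra.
exists (m^-1 *: d) => [x /dC dx|]; rewrite dotpZl mulrC.
  by rewrite ler_pdivrMr// mul1r (le_trans dx)// /m; lra.
by rewrite ltr_pdivlMr// mul1r /m; lra.
Qed.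

End DotProduct.

(** * Gauge functions and their duality with the polar *)

Section Gauge.
Variables (R : realType) (n : nat).
Implicit Types (C : set 'rV[R]_n) (a x y z : 'rV[R]_n) (l : R).

Lemma gaugefE C x (r : R) : 0 <= r ->
  (forall l, 0 <= l -> scale_set l C x <-> r <= l) -> gaugef C x = r.
Proof.
move=> r0 Cr; apply: minimumE; split; first by split=> //; apply/Cr.
by move=> l [l0 /(Cr _ l0)].
Qed.

Lemma gaugef_opp C x : gaugef (opp_set C) x = gaugef C (- x).
Proof.
congr minimum; apply/seteqP; split=> l [l0 lC]; split=> //.
  case: lC => _ [c Cc <-] <-; exists c => //.
  by rewrite scaleN1r scalerN opprK.
case: lC => c Cc cx; exists (- c); last by rewrite scalerN cx opprK.
by exists c => //; rewrite scaleN1r.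
Qed.

Section ConvexGauge.
Variable C : set 'rV[R]_n.
Hypotheses (cC : compact C) (C0 : interior C 0)
  (convC : convex_set (C : set (convex_lmodType 'rV[R]_n))).

Lemma gaugef_ge0 x : 0 <= gaugef C x.
Proof. by have [[]] := gaugefP x cC C0. Qed.

Lemma gaugef_attained x : exists2 c, C c & gaugef C x *: c = x.
Proof. by have [[_ []]] := gaugefP x cC C0 => c; exists c. Qed.

(** A convex set containing 0 grows under dilation, so the infimum defining the
    gauge can be tested at any single scale. *)
Lemma gaugef_leP x l : 0 <= l -> (gaugef C x <= l <-> scale_set l C x).
Proof.
move=> l0; split=> [gl|lx]; last by have [_] := gaugefP x cC C0; apply.
have [c Cc cx] := gaugef_attained x; have g0 := gaugef_ge0 x.
move: l0; rewrite le0r => /orP[/eqP l0|l_gt0].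
  by exists c => //; rewrite -cx; congr (_ *: _); lra.
exists (gaugef C x / l *: c + (1 - gaugef C x / l) *: 0).
  apply: convex_set_comb => //; last exact: nbhs_singleton.
  by rewrite divr_ge0 ?(ltW l_gt0)//= ler_pdivrMr// mul1r.
by rewrite scaler0 addr0 scalerA mulrCA divff ?gt_eqF// mulr1.
Qed.

Lemma gaugef_eq0 x : gaugef C x = 0 -> x = 0.
Proof. by move=> g0; have [c _] := gaugef_attained x; rewrite g0 scale0r. Qed.

(** With g = ||x||_C and h = ||y||_C, convexity gives g C + h C = (g + h) C. *)
Lemma ler_gaugefD x y : gaugef C (x + y) <= gaugef C x + gaugef C y.
Proof.
have gx := gaugef_ge0 x; have gy := gaugef_ge0 y.
apply/gaugef_leP; first exact: addr_ge0.
have [c Cc cx] := gaugef_attained x; have [d Cd dy] := gaugef_attained y.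
have [/eqP|gxy] := eqVneq (gaugef C x + gaugef C y) 0.
  rewrite paddr_eq0// => /andP[/eqP x0 /eqP y0].
  exists c => //; rewrite x0 y0 addr0 scale0r.
  by move: cx dy; rewrite x0 y0 !scale0r => <- <-; rewrite addr0.
set t := gaugef C x / (gaugef C x + gaugef C y).
have t1 : 1 - t = gaugef C y / (gaugef C x + gaugef C y).
  by rewrite /t; field.
exists (t *: c + (1 - t) *: d).
  apply: convex_set_comb => //; apply/andP; split; first by rewrite divr_ge0 ?addr_ge0.
  by rewrite -subr_ge0 t1 divr_ge0 ?addr_ge0.
by rewrite t1 scalerDr !scalerA !(mulrC (_ + _)) !divfK// cx dy.
Qed.

Lemma gaugefZ_le l x : 0 <= l -> gaugef C (l *: x) <= l * gaugef C x.
Proof.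
move=> l0; apply/gaugef_leP; first by rewrite mulr_ge0// gaugef_ge0.
by have [c Cc cx] := gaugef_attained x; exists c => //; rewrite -scalerA cx.
Qed.

Lemma gaugefZ l x : 0 <= l -> gaugef C (l *: x) = l * gaugef C x.
Proof.
move=> l0; apply/eqP; rewrite eq_le gaugefZ_le//=.
move: l0; rewrite le0r => /orP[/eqP->|l_gt0]; first by rewrite mul0r gaugef_ge0.
rewrite -ler_pdivlMl//.
by rewrite -[in leLHS](scalerK (lt0r_neq0 l_gt0) x) gaugefZ_le// invr_ge0 ltW.
Qed.

Lemma dotp_le_gaugef a x : polar C a -> dotp a x <= gaugef C x.
Proof.
move=> aC; have [c Cc {1}<-] := gaugef_attained x.
by rewrite dotpZr ler_piMr ?gaugef_ge0// aC.
Qed.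

(** Together with [dotp_le_gaugef], this says that ||x||_C is the supremum of
    a.x over the polar of C. *)
Lemma lt_gaugef_dotp (u : R) x : u < gaugef C x ->
  exists2 a, polar C a & u < dotp a x.
Proof.
move=> ug; have [u0|u0] := ltP u 0.
  exists 0 => [y _|]; rewrite -(scale0r (0 : 'rV_n)) dotpZl mul0r//.
(* Dividing by u itself is impossible when u = 0, hence a scale v strictly
   between u and the gauge: x / v is outside C and can be separated from it. *)
pose v := (u + gaugef C x) / 2.
have v0 : 0 < v by rewrite /v; lra.
have vC : ~ C (v^-1 *: x).
  move=> vC; suff : gaugef C x <= v by rewrite /v; lra.
  apply/gaugef_leP; first exact: ltW.
  by exists (v^-1 *: x) => //; rewrite scalerA divff ?gt_eqF// scale1r.
have [a aC] := polar_separation cC convC (nbhs_singleton C0) vC.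
rewrite dotpZr ltr_pdivlMl// mulr1 => va.
by exists a => //; apply: lt_trans va; rewrite /v; lra.
Qed.

End ConvexGauge.

(** * Norms and their unit balls *)

Definition vector_norm (f : 'rV[R]_n -> R) :=
  [/\ forall x y, f (x + y) <= f x + f y, forall l x, f (l *: x) = `|l| * f x
    & forall x, f x = 0 -> x = 0].

Definition unit_ball (f : 'rV[R]_n -> R) : set 'rV[R]_n := [set x | f x <= 1].

Section VectorNorm.
Variable f : 'rV[R]_n -> R.
Hypothesis normf : vector_norm f.

Lemma vector_norm0 : f 0 = 0.
Proof. by case: normf => _ fZ _; rewrite -(scale0r 0) fZ normr0 mul0r. Qed.

Lemma vector_normN x : f (- x) = f x.
Proof. by case: normf => _ fZ _; rewrite -scaleN1r fZ normrN1 mul1r. Qed.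

Lemma vector_norm_ge0 x : 0 <= f x.
Proof.
case: normf => fD _ _; have := fD x (- x).
by rewrite subrr vector_norm0 vector_normN; lra.
Qed.

Lemma scale_unit_ballP l x : 0 <= l -> (scale_set l (unit_ball f) x <-> f x <= l).
Proof.
case: normf => _ fZ f0 l0; split=> [[c c1 <-]|].
  by rewrite fZ ger0_norm// ler_piMr.
move: l0; rewrite le0r => /orP[/eqP->|l_gt0 fl].
  move=> fx0; exists 0; first by rewrite /unit_ball/= vector_norm0.
  rewrite scaler0; apply/esym/f0/eqP; rewrite eq_le fx0; exact: vector_norm_ge0.
exists (l^-1 *: x); last by rewrite scalerA divff ?gt_eqF// scale1r.
by rewrite /unit_ball/= fZ ger0_norm ?invr_ge0 ?(ltW l_gt0)// ler_pdivrMl// mulr1.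
Qed.

Lemma gaugef_unit_ball x : gaugef (unit_ball f) x = f x.
Proof. apply: gaugefE; [exact: vector_norm_ge0|move=> l; exact: scale_unit_ballP]. Qed.

(** The ball of radius f (x - y) / 2 around the midpoint contains the segment,
    and no smaller ball contains both endpoints, by the triangle inequality. *)
Lemma circumradius_segment x y :
  circumradius (segment x y) (unit_ball f) = f (x - y) / 2.
Proof.
case: normf => fD fZ f0.
have f2 : 0 <= f (x - y) / 2 by rewrite divr_ge0 ?vector_norm_ge0.
rewrite /circumradius; set A := (X in inf X); have lbA : lbound A (f (x - y) / 2).
  move=> r [r0 [t xyB]].
  have /xyB[u /(scale_unit_ballP _ r0) fu xu] : segment x y x.
    by exists 0; rewrite /= ?in_itv/= ?lexx ?ler01// subr0 scale1r scale0r addr0.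
  have /xyB[v /(scale_unit_ballP _ r0) fv yv] : segment x y y.
    by exists 1; rewrite /= ?in_itv/= ?lexx ?ler01// subrr scale1r scale0r add0r.
  have -> : x - y = u + - v by rewrite -xu -yv opprD addrACA subrr add0r.
  by have := fD u (- v); rewrite vector_normN; lra.
have Axy : A (f (x - y) / 2).
  split=> //; exists (2^-1 *: (x + y)) => _ [l /= + <-].
  rewrite in_itv/= => /andP[l0 l1]; exists ((2^-1 - l) *: (x - y)).
    apply/scale_unit_ballP => //; rewrite fZ mulrC ler_wpM2l ?vector_norm_ge0//.
    by rewrite ler_norml; apply/andP; split; lra.
  by apply/rowP => i; rewrite !mxE; field.
apply/eqP; rewrite eq_le; apply/andP; split.
  by apply: ge_inf => //; exists (f (x - y) / 2).
by apply: lb_le_inf => //; exists (f (x - y) / 2).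
Qed.

(** By subadditivity and homogeneity on the canonical basis, f is bounded by a
    multiple of the sup norm, hence Lipschitz. *)
Lemma vector_norm_continuous : continuous f.
Proof.
case: normf => fD fZ f0; pose M := \sum_(i < n) f (delta_mx 0 i).
have M0 : 0 <= M by apply: sumr_ge0 => i _; exact: vector_norm_ge0.
have fM x : f x <= M * `|x|.
  rewrite {1}[x]row_sum_delta.
  apply: (@le_trans _ _ (\sum_(i < n) f (x 0 i *: delta_mx 0 i))).
    elim/big_ind2: _ => //; first by rewrite vector_norm0.
    by move=> u r v q ur vq; apply: le_trans (fD _ _) _; exact: lerD.
  rewrite mulr_suml; apply: ler_sum => i _; rewrite fZ mulrC.
  rewrite ler_wpM2l ?vector_norm_ge0// /Num.norm/= mx_normrE.
  exact: (le_bigmax _ (fun ij => `|x ij.1 ij.2|) (0, i)).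
move=> x; apply/(@cvgrPdist_le R R^o _ (nbhs x) (nbhs_filter x)) => e e0; near=> y.
have fB u v : f u - f v <= f (u - v).
  by rewrite lerBlDr -{1}(subrK v u) fD.
have fxy : `|f x - f y| <= f (x - y).
  by rewrite ler_norml fB andbT lerNl opprB -[leRHS]vector_normN opprB fB.
apply: le_trans fxy (le_trans (fM _) _).
(* M may be 0, so M + 1 is used to divide by. *)
rewrite (@le_trans _ _ ((M + 1) * `|x - y|))// ?ler_wpM2r ?lerDl//.
rewrite -ler_pdivlMl ?ltr_wpDl//.
near: y; apply: cvgr_dist_le; first exact: cvg_id.
by rewrite mulr_gt0 ?invr_gt0 ?ltr_wpDl.
Unshelve. all: by end_near. Qed.

End VectorNorm.

(** * The norm of the harmonic mean body *)

Definition gauge_mean C x : R := 2^-1 * (gaugef C x + gaugef C (- x)).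

(** Subadditivity and definiteness come from the gauge; averaging over x and -x
    turns its positive homogeneity into full homogeneity. *)
Lemma vector_norm_gauge_mean C : compact C -> interior C 0 ->
    convex_set (C : set (convex_lmodType 'rV[R]_n)) ->
  vector_norm (gauge_mean C).
Proof.
move=> cC C0 convC; rewrite /gauge_mean; split=> [x y|l x|x gx].
- have := ler_gaugefD cC C0 convC x y.
  by have := ler_gaugefD cC C0 convC (- x) (- y); rewrite opprD; lra.
- have [l0|/ltW l0] := leP 0 l.
    by rewrite ger0_norm// -scalerN !gaugefZ//; ring.
  have lx : l *: x = - l *: - x by rewrite scaleNr scalerN opprK.
  by rewrite ler0_norm// -scaleNr lx !gaugefZ// ?oppr_ge0//; ring.
- apply: (gaugef_eq0 cC C0).
  by have := gaugef_ge0 cC C0 x; have := gaugef_ge0 cC C0 (- x); lra.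
Qed.

(** The support function of half of (polar C - polar C) at x is half the sum of
    those of the polar of C at x and at -x, that is, gauge_mean C x. *)
Lemma HM_bodyE C : compact C -> interior C 0 ->
    convex_set (C : set (convex_lmodType 'rV[R]_n)) ->
  HM_body C = unit_ball (gauge_mean C).
Proof.
move=> cC C0 convC; apply/seteqP; split=> x; rewrite /unit_ball/= /gauge_mean; last first.
  move=> gx _ [_ [a aC [b bC <-]] <-].
  rewrite dotpC dotpZl dotpBl -dotpNr.
  have := dotp_le_gaugef cC C0 x aC.
  by have := dotp_le_gaugef cC C0 (- x) bC; lra.
move=> HMx; rewrite leNgt; apply/negP => gx.
(* Functionals a and b within e of the two gauges have a.x + b.(-x) > 2. *)
pose e := (gaugef C x + gaugef C (- x) - 2) / 2.
have [|a aC ea] := lt_gaugef_dotp cC C0 convC (u := gaugef C x - e) (x := x).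
  by rewrite /e; lra.
have [|b bC eb] := lt_gaugef_dotp cC C0 convC (u := gaugef C (- x) - e) (x := - x).
  by rewrite /e; lra.
have /HMx : half_diff (polar C) (2^-1 *: (a - b)).
  by exists (a - b) => //; exists a => //; exists b.
rewrite dotpC dotpZl dotpBl; move: ea eb; rewrite dotpNr /e; lra.
Qed.

End Gauge.

(** * Chords and the maximal lengths *)

Section Chords.
Variables (R : realType) (n : nat).
Implicit Types (K C : set 'rV[R]_n) (s x y z : 'rV[R]_n) (f : 'rV[R]_n -> R).

(** (a - b) / 2 - (c - d) / 2 is the difference of the midpoints of a, d and of
    b, c, and x - y = (x - y) / 2 - (y - x) / 2. *)
Lemma diff_set_half_diff K : convex_set (K : set (convex_lmodType 'rV[R]_n)) ->
  diff_set (half_diff K) (half_diff K) = diff_set K K.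
Proof.
move=> convK; have mid x y : K x -> K y -> K (2^-1 *: (x + y)).
  move=> Kx Ky; have : K (2^-1 *: x + (1 - 2^-1) *: y).
    by apply: convex_set_comb => //; apply/andP; split; lra.
  by congr K; rewrite scalerDr; congr (_ + _ *: _); field.
apply/seteqP; split=> [_ [_ [_ [a Ka [b Kb <-]] <-] [_ [_ [c Kc [d Kd <-]] <-] <-]]|].
  exists (2^-1 *: (a + d)); first exact: mid.
  exists (2^-1 *: (b + c)); first exact: mid.
  by apply/rowP => i; rewrite !mxE; ring.
move=> _ [x Kx [y Ky <-]].
exists (2^-1 *: (x - y)); first by exists (x - y) => //; exists x => //; exists y.
exists (2^-1 *: (y - x)); first by exists (y - x) => //; exists y => //; exists x.
by apply/rowP => i; rewrite !mxE; field.
Qed.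

Lemma chord_values_diff f s K :
  chord_values (fun x y => f (x - y)) s K = f @` (diff_set K K `&` line s).
Proof.
apply/seteqP; split=> [_ [x [y [Kx Ky sxy ->]]]|_ [_ [[x Kx [y Ky <-]] sxy] <-]].
  by exists (x - y) => //; split=> //; exists x => //; exists y.
by exists x, y.
Qed.

Lemma compact_diff_set K : compact K -> compact (diff_set K K).
Proof.
move=> cK.
have -> : diff_set K K = (fun z : 'rV[R]_n * 'rV[R]_n => z.1 - z.2) @` (K `*` K).
  apply/seteqP; split=> [_ [x Kx [y Ky <-]]|_ [[x y] [Kx Ky] <-]].
    by exists (x, y).
  by exists x => //; exists y.
apply: continuous_compact; last exact: compact_setX.
apply: continuous_subspaceT => z.
by apply: cvgB; [exact: cvg_fst|exact: cvg_snd].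
Qed.

Lemma closed_line s : closed (line s).
Proof.
have [->|/rV0Pn[j sj]] := eqVneq s 0.
  have -> : line 0 = [set (0 : 'rV[R]_n)].
    apply/seteqP; split=> [_ [l _ <-]|_ ->]; first by rewrite scaler0.
    by exists 0; rewrite ?scaler0.
  exact/accessible_closed_set1/hausdorff_accessible/norm_hausdorff.
(* The scalar carrying s to z can only be the ratio of their j-th coordinates. *)
have -> : line s = [set z : 'rV[R]_n | z - (z 0 j / s 0 j) *: s = 0].
  apply/seteqP; split=> [_ [l _ <-]/=|z /= /eqP].
    by rewrite mxE mulfK// subrr.
  by rewrite subr_eq0 => /eqP zs; exists (z 0 j / s 0 j).
have cf : continuous (fun z : 'rV[R]_n => z - (z 0 j / s 0 j) *: s).
  move=> z.
  apply: (@continuousB R _ _ id (fun z : 'rV[R]_n => (z 0 j / s 0 j) *: s)).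
    exact: cvg_id.
  apply: (@continuous_comp _ _ _ (fun z : 'rV[R]_n => z 0 j / s 0 j)
    (fun l : R => l *: s)).
    apply: (@continuousM R _ (fun z : 'rV[R]_n => z 0 j) (cst (s 0 j)^-1)).
      exact: coord_continuous.
    exact: cst_continuous.
  exact: scalel_continuous.
apply: (iffLR (continuous_closedP _) cf [set 0]).
exact/accessible_closed_set1/hausdorff_accessible/norm_hausdorff.
Qed.

Lemma has_max_image f (A : set 'rV[R]_n) :
  continuous f -> compact A -> A !=set0 -> has_max (f @` A).
Proof.
move=> cf cA A0.
have [z /set_mem Az fz] := @EVT_max_rV R n f A A0 cA (continuous_subspaceT cf).
exists (f z); split; first by exists z.
by move=> _ [y Ay <-]; apply/fz/mem_set.
Qed.

Lemma has_max_chord_values f s K : continuous f -> compact K -> K !=set0 ->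
  has_max (chord_values (fun x y => f (x - y)) s K).
Proof.
move=> cf cK [x Kx]; rewrite chord_values_diff; apply: has_max_image => //.
  apply: compact_closedI; [exact: compact_diff_set|exact: closed_line].
exists 0; split; first by exists x => //; exists x => //; rewrite subrr.
by exists 0; rewrite ?scale0r.
Qed.

Lemma maximumP (A : set R) : has_max A -> is_max A (maximum A).
Proof. by move=> [m mA]; rewrite (maximumE mA). Qed.

(** A maximizer z of f over K - K is parallel to some nonzero t, and the length
    in the direction t already attains f z. *)
Lemma has_max_chord_lengths f s K : s != 0 -> continuous f -> compact K -> K !=set0 ->
  has_max [set maximum (chord_values (fun x y => f (x - y)) t K) | t in [set t | t != 0]].
Proof.
move=> s0 cf cK [k Kk].
have [|_ [[z [x Kx [y Ky xyz]] <-] fz]] := has_max_image cf (compact_diff_set cK).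
  by exists (k - k), k => //; exists k.
have chordP t := maximumP (has_max_chord_values t cf cK (ex_intro _ k Kk)).
(* When K is a single point, z = 0 and any direction will do. *)
have [t t0 tz] : exists2 t, t != 0 & line t z.
  have [->|z0] := eqVneq z 0; first by exists s => //; exists 0; rewrite ?scale0r.
  by exists z => //; exists 1; rewrite ?scale1r.
exists (f z); split.
  exists t => //; apply: maximumE; split; first by exists x, y; rewrite xyz.
  move=> _ [u [v [Ku Kv _ ->]]].
  by apply: fz; exists (u - v) => //; exists u => //; exists v.
move=> _ [u _ <-]; have [[v [w [Kv Kw _ ->]]] _] := chordP u.
by apply: fz; exists (v - w) => //; exists v => //; exists w.
Qed.

End Chords.

(* The [has_max] conjuncts say that every maximum in the two chains of
   equalities is attained. *)
Theorem lemma2p6 (R : realType) (n : nat) (K C : set 'rV[R]_n) (s : 'rV[R]_n) :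
  (2 <= n)%N ->
  convex_body K ->
  convex_body C -> interior C 0 -> minkowski_centered C ->
  s != 0 ->
  (* (i) *)
  ([/\ lHM s K C = maximum (chord_values (len (HM_body C)) s K),
       maximum (chord_values (len (HM_body C)) s K) = lHM s K (HM_body C),
       lHM s K (HM_body C) = lAM s K (HM_body C),
       lAM s K (HM_body C) = lHM s (half_diff K) (HM_body C) &
       lHM s (half_diff K) (HM_body C) = lHM s (half_diff K) C]
   /\
   [/\ has_max (chord_values (lenHM C) s K),
       has_max (chord_values (len (HM_body C)) s K),
       has_max (chord_values (lenHM (HM_body C)) s K) &
       has_max (chord_values (lenAM (HM_body C)) s K)]
   /\
   [/\ has_max (chord_values (lenHM (HM_body C)) s (half_diff K)) &
       has_max (chord_values (lenHM C) s (half_diff K))])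
  /\
  (* (ii) *)
  ([/\ DHM K C = DHM K (HM_body C),
       DHM K (HM_body C) = DHM (half_diff K) (HM_body C),
       DHM (half_diff K) (HM_body C) = DHM (half_diff K) C &
       DHM (half_diff K) C = DAM K (HM_body C)]
   /\
   [/\ has_max (lHM_values K C),
       has_max (lHM_values K (HM_body C)),
       has_max (lHM_values (half_diff K) (HM_body C)),
       has_max (lHM_values (half_diff K) C) &
       has_max (lAM_values K (HM_body C))]).
Proof.
move=> _ [K0 cK convK] [_ cC convC] C0 _ s0.
have normN := vector_norm_gauge_mean cC C0 convC.
have HM := HM_bodyE cC C0 convC.
set N := gauge_mean C in normN HM.
have cN : continuous N := @vector_norm_continuous _ _ _ normN.
pose d x y := N (x - y).
have lenHM_C : lenHM C = d.
  by apply/funext => x; apply/funext => y; rewrite /lenHM gaugef_opp.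
have len_HM : len (HM_body C) = d.
  by apply/funext => x; apply/funext => y; rewrite /len HM gaugef_unit_ball.
have lenHM_HM : lenHM (HM_body C) = d.
  apply/funext => x; apply/funext => y.
  by rewrite /lenHM gaugef_opp HM !gaugef_unit_ball// (vector_normN normN)// /d; field.
have lenAM_HM : lenAM (HM_body C) = d.
  apply/funext => x; apply/funext => y.
  by rewrite /lenAM HM circumradius_segment// mulrC divfK.
have half_chords t : chord_values d t (half_diff K) = chord_values d t K.
  by rewrite !chord_values_diff diff_set_half_diff.
have half_lengths : [set maximum (chord_values d t (half_diff K)) | t in [set t | t != 0]]
    = [set maximum (chord_values d t K) | t in [set t | t != 0]].
  by apply: eq_imagel => t _; rewrite half_chords.
have max_s := has_max_chord_values s cN cK K0.
have max_D := has_max_chord_lengths s0 cN cK K0.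
rewrite /DHM /DAM /lHM_values /lAM_values /lHM /lAM.
rewrite lenHM_C len_HM lenHM_HM lenAM_HM half_chords half_lengths.
by split; split.
Qed.
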